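(* Let $\mathcal{P}$ be the set of rational polyhedra $P\subseteq\mathbb{R}^n$ (for some $n$) such that for any $k\in\mathbb{Z}_{\geq 0}$, any $r\in\{0,\ldots,k\}$ and any $w\in\mathbb{Z}^n$, the intersection $rP\cap(w-(k-r)P)$ is box-integer. If $P\in\mathcal{P}$, then $P$ has the Integer Carathéodory Property.
   Context: For a real number $t\ge 0$ and $P\subseteq\mathbb{R}^n$, $tP=\{tx: x\in P\}$, and $w-tP=\{w-tx: x\in P\}$. Inequalities between vectors are componentwise. Let $\bar{\mathbb{Z}}=\mathbb{Z}\cup\{-\infty,+\infty\}$. A polyhedron is called an integer polyhedron if each of its (nonempty) faces contains an integer point (in particular the empty polyhedron is an integer polyhedron). A polyhedron $Q\subseteq\mathbb{R}^n$ is box-integer if for every pair of vectors $c\le d$ in $\bar{\mathbb{Z}}^n$, the set $\{x\in Q: c\le x\le d\}$ is an integer polyhedron. A polyhedron $P\subseteq\mathbb{R}^n$ has the Integer Carathéodory Property (ICP) if for every positive integer $k$ and every integer vector $w\in kP$ there exist affinely independent $x_1,\ldots,x_t\in P\cap\mathbb{Z}^n$ and $n_1,\ldots,n_t\in\mathbb{Z}_{\ge 0}$ such that $n_1+\cdots+n_t=k$ and $w=\sum_{i} n_i x_i$. *)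

(* Defs.v *)
From mathcomp Require Import all_boot all_order all_algebra.
From mathcomp Require Import classical_sets reals constructive_ereal.

Set Implicit Arguments.
Unset Strict Implicit.
Unset Printing Implicit Defensive.

Import Order.TTheory GRing.Theory Num.Theory.
Local Open Scope ring_scope.
Local Open Scope classical_set_scope.

(* Points of R^n are column vectors; linear functionals are row vectors. *)

Definition halfspaces (R : realType) (m n : nat)
    (A : 'M[R]_(m, n)) (b : 'cV[R]_m) : set 'cV[R]_n :=
  [set x : 'cV[R]_n | forall i, (A *m x) i 0 <= b i 0].

Definition polyhedron (R : realType) (n : nat) (P : set 'cV[R]_n) : Prop :=
  exists (m : nat) (A : 'M[R]_(m, n)) (b : 'cV[R]_m), P = halfspaces A b.

Definition rational_polyhedron (R : realType) (n : nat)
    (P : set 'cV[R]_n) : Prop :=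
  exists (m : nat) (A : 'M[rat]_(m, n)) (b : 'cV[rat]_m),
    P = halfspaces (map_mx ratr A) (map_mx ratr b).

(* [c = 0] gives the improper faces: [Q] itself and the empty set. *)
Definition face (R : realType) (n : nat) (Q F : set 'cV[R]_n) : Prop :=
  exists (c : 'rV[R]_n) (delta : R),
    (forall x, Q x -> (c *m x) 0 0 <= delta) /\
    F = Q `&` [set x : 'cV[R]_n | (c *m x) 0 0 = delta].

Definition integer_vector (R : realType) (n : nat) (x : 'cV[R]_n) : Prop :=
  x \is a mxOver Num.int.

Definition integer_polyhedron (R : realType) (n : nat)
    (Q : set 'cV[R]_n) : Prop :=
  polyhedron Q /\
  forall F, face Q F -> F !=set0 -> exists x, F x /\ integer_vector x.

(* The bounds lie in [\bar int], the integers extended with [-oo] and [+oo];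
   they are compared with real coordinates in [\bar R]. *)
Definition box (R : realType) (n : nat) (c d : 'cV[\bar int]_n) :
    set 'cV[R]_n :=
  [set x : 'cV[R]_n | forall i,
     (er_map intr (c i 0%R) <= (x i 0%R)%:E <= er_map intr (d i 0%R))%E].

Definition box_integer (R : realType) (n : nat) (Q : set 'cV[R]_n) : Prop :=
  polyhedron Q /\
  forall c d : 'cV[\bar int]_n, (forall i, (c i 0%R <= d i 0%R)%E) ->
    integer_polyhedron (Q `&` box c d).

Definition dilate (R : realType) (n : nat) (t : R) (P : set 'cV[R]_n) :
    set 'cV[R]_n :=
  [set t *: x | x in P].

Definition sub_dilate (R : realType) (n : nat) (w : 'cV[R]_n) (t : R)
    (P : set 'cV[R]_n) : set 'cV[R]_n :=
  [set w - t *: x | x in P].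

Definition calP (R : realType) (n : nat) (P : set 'cV[R]_n) : Prop :=
  rational_polyhedron P /\
  forall (k r : nat) (w : 'cV[R]_n), (r <= k)%N -> integer_vector w ->
    box_integer (dilate r%:R P `&` sub_dilate w (k - r)%N%:R P).

Definition affinely_independent (R : realType) (n t : nat)
    (x : 'I_t -> 'cV[R]_n) : Prop :=
  forall a : 'I_t -> R,
    \sum_i a i = 0 -> \sum_i a i *: x i = 0 -> forall i, a i = 0.

Definition ICP (R : realType) (n : nat) (P : set 'cV[R]_n) : Prop :=
  forall (k : nat) (w : 'cV[R]_n),
    (0 < k)%N -> integer_vector w -> dilate k%:R P w ->
    exists (t : nat) (x : 'I_t -> 'cV[R]_n) (m : 'I_t -> nat),
      [/\ affinely_independent x,
          forall i, P (x i) /\ integer_vector (x i),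
          (\sum_i m i = k)%N
        & w = \sum_i (m i)%:R *: x i].

(* Main.v *)
Require Import Defs.
From mathcomp Require Import all_boot all_order all_algebra.
From mathcomp Require Import classical_sets reals.
From mathcomp Require Import boolp constructive_ereal lra zify.

(* Intersecting P with the box [l, l + 1], where l = floor (w / k), preserves the
   integrality of the sets r P `&` (w - (k - r) P) and makes P bounded with all
   coordinates of integer points in {l_i, l_i + 1}.  Taking r = 1 repeatedly
   writes w as a sum of k integer points of P.  If coordinate i is not constant,
   collect the summands with x_i = l_i + 1 and those with x_i = l_i: w = y + z
   with y in r P_1 and z in (k - r) P_0, for two disjoint faces P_1, P_0 of P.
   Replace y by an integer vertex of r P_1 `&` (w - (k - r) P_0).  If F and G are
   the minimal faces of P with y in r F and z in (k - r) G, being a vertex means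
   that the directions of F and G meet only in 0, while their affine hulls are
   separated by coordinate i.  Hence affinely independent points of F and of G
   are affinely independent together, and one concludes by induction on the
   number of non-constant coordinates, applied to y and z. *)

Set Implicit Arguments.
Unset Strict Implicit.
Unset Printing Implicit Defensive.

Import fintype.
Import Order.TTheory GRing.Theory Num.Theory.
Local Open Scope ring_scope.
Local Open Scope classical_set_scope.

(** * Linear functionals on column vectors *)

Definition dot (R : realType) (n : nat) (c : 'rV[R]_n) (x : 'cV[R]_n) : R :=
  (c *m x) 0 0.

Lemma dotDr (R : realType) n (c : 'rV[R]_n) (x y : 'cV[R]_n) :
  dot c (x + y) = dot c x + dot c y.
Proof. by rewrite /dot mulmxDr mxE. Qed.

Lemma dotNr (R : realType) n (c : 'rV[R]_n) (x : 'cV[R]_n) :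
  dot c (- x) = - dot c x.
Proof. by rewrite /dot mulmxN mxE. Qed.

Lemma dotBr (R : realType) n (c : 'rV[R]_n) (x y : 'cV[R]_n) :
  dot c (x - y) = dot c x - dot c y.
Proof. by rewrite dotDr dotNr. Qed.

Lemma dotNl (R : realType) n (c : 'rV[R]_n) (x : 'cV[R]_n) :
  dot (- c) x = - dot c x.
Proof. by rewrite /dot mulNmx mxE. Qed.

Lemma dotZr (R : realType) n (c : 'rV[R]_n) (a : R) (x : 'cV[R]_n) :
  dot c (a *: x) = a * dot c x.
Proof. by rewrite /dot -scalemxAr mxE. Qed.

Lemma dot_sumr (R : realType) n (c : 'rV[R]_n) I (s : seq I) (P : pred I)
    (x : I -> 'cV[R]_n) :
  dot c (\sum_(i <- s | P i) x i) = \sum_(i <- s | P i) dot c (x i).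
Proof. by rewrite /dot mulmx_sumr summxE. Qed.

Lemma dot_suml (R : realType) n I (s : seq I) (P : pred I)
    (c : I -> 'rV[R]_n) (x : 'cV[R]_n) :
  dot (\sum_(i <- s | P i) c i) x = \sum_(i <- s | P i) dot (c i) x.
Proof. by rewrite /dot mulmx_suml summxE. Qed.

Lemma dot_delta (R : realType) n (i : 'I_n) (x : 'cV[R]_n) :
  dot (delta_mx 0 i) x = x i 0.
Proof. by rewrite /dot -rowE mxE. Qed.

(** * Faces, tight inequalities and integer vertices *)

Definition poly_of (R : realType) (n : nat) (S : finType)
    (G : S -> 'rV[R]_n) (H : S -> R) : set 'cV[R]_n :=
  [set x | forall s, dot (G s) x <= H s].

Definition tight (R : realType) (n : nat) (S : finType)
    (G : S -> 'rV[R]_n) (H : S -> R) (x : 'cV[R]_n) : {set S} :=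
  [set s | dot (G s) x == H s]%SET.

(** The sum of the inequalities in [S0] is valid, and it is an equality at a point exactly when
    every nonnegative slack in the sum vanishes. *)
Lemma tight_face (R : realType) n (S : finType)
    (G : S -> 'rV[R]_n) (H : S -> R) (S0 : {set S}) :
  face (poly_of G H) (poly_of G H `&` [set x | S0 \subset tight G H x]).
Proof.
exists (\sum_(s in S0) G s), (\sum_(s in S0) H s); split=> [x Qx|].
  by rewrite -/(dot _ x) dot_suml ler_sum.
apply/seteqP; split=> x [Qx] /= Tx; split=> //=.
  rewrite -/(dot _ x) dot_suml; apply: eq_bigr => s sS0.
  by move/subsetP/(_ _ sS0): Tx; rewrite inE => /eqP.
apply/subsetP => s sS0; rewrite inE eq_sym -subr_eq0; apply/eqP.
apply: (psumr_eq0P (P := [in S0]) (F := fun s => H s - dot (G s) x)) => //.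
  by move=> u _; rewrite subr_ge0 Qx.
by rewrite sumrB -dot_suml -Tx subrr.
Qed.

(** Moving from [y] along [v] keeps the tight inequalities tight. As some left-hand side grows along
    [v], a further inequality eventually blocks the way and becomes tight. *)
Lemma tight_step (R : realType) n (S : finType)
    (G : S -> 'rV[R]_n) (H : S -> R) (y v : 'cV[R]_n) :
  poly_of G H y -> (forall s, s \in tight G H y -> dot (G s) v = 0) ->
  (exists s, 0 < dot (G s) v) ->
  exists y', poly_of G H y' /\ tight G H y \proper tight G H y'.
Proof.
move=> Qy vT [s0 s0v].
(* Ratio test: [f s] is the step length at which [s] becomes tight; the smallest one keeps the point
   feasible. *)
pose f s := (H s - dot (G s) y) / dot (G s) v.
case: (arg_minP (P := fun s => 0 < dot (G s) v) f s0v) => s sv smin.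
have fs0 : 0 <= f s by rewrite divr_ge0 ?subr_ge0 ?Qy // ltW.
exists (y + f s *: v); split=> [u|].
  rewrite dotDr dotZr; have [uv|uv] := ltP 0 (dot (G u) v).
    by have := smin u uv; rewrite {2}/f ler_pdivlMr // lerBrDl.
  have : f s * dot (G u) v <= 0 by rewrite mulr_ge0_le0.
  by move=> le0; rewrite -(addr0 (H u)) lerD.
apply/properP; split.
  apply/subsetP => u uT; rewrite inE dotDr dotZr (vT u uT) mulr0 addr0.
  by move: uT; rewrite inE.
exists s; first by rewrite inE dotDr dotZr /f divfK ?lt0r_neq0 // addrC subrK.
by apply/negP => /vT sv0; rewrite sv0 ltxx in sv.
Qed.

(* An integer point of the face cut out by a maximal tight set has no larger
   tight set, so moving along a line in its minimal face is impossible. *)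
Lemma integer_vertex (R : realType) n (S : finType)
    (G : S -> 'rV[R]_n) (H : S -> R) (S0 : {set S}) (y0 : 'cV[R]_n) :
  (forall F, face (poly_of G H) F -> F !=set0 ->
     exists x, F x /\ integer_vector x) ->
  (forall v, v != 0 -> exists s, 0 < dot (G s) v) ->
  poly_of G H y0 -> S0 \subset tight G H y0 ->
  exists y, [/\ poly_of G H y, integer_vector y, S0 \subset tight G H y &
    forall v, (forall s, s \in tight G H y -> dot (G s) v = 0) -> v = 0].
Proof.
move=> intF bnd Qy0 S0y0.
pose good y := poly_of G H y /\ S0 \subset tight G H y.
pose p m := `[< exists y, good y /\ #|tight G H y| = m >].
have exp : exists m, p m by exists #|tight G H y0|; apply/asboolP; exists y0.
have ubp m : p m -> (m <= #|S|)%N.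
  by move=> /asboolP[y [_ <-]]; exact: max_card.
case: (ex_maxnP exp ubp) => m /asboolP[y1 [[Qy1 S0y1] my1]] mmax.
have [|y [[Qy /= ty] yint]] := intF _ (tight_face G H (tight G H y1)).
  by exists y1; split => /=.
have S0y := subset_trans S0y1 ty.
exists y; split=> // v vT; apply: contrapT => /eqP v0.
have [y' [Qy' ltT]] := tight_step Qy vT (bnd v v0).
have := mmax #|tight G H y'|; rewrite leqNgt -my1.
rewrite (leq_ltn_trans (subset_leq_card ty) (proper_card ltT)) => /(_ _)/negP.
case=> //; apply/asboolP; exists y'; split=> //; split=> //.
exact: subset_trans S0y (proper_sub ltT).
Qed.

(** * Dilated faces *)

(* For [k > 0], [k] times the face of [{x | forall t, dot (g t) x <= h t}] where
   [J] is tight; for [k = 0], the recession cone of that face, not [{0}]. *)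
Definition dface (R : realType) (n : nat) (T : finType) (g : T -> 'rV[R]_n)
    (h : T -> R) (J : {set T}) (k : nat) : set 'cV[R]_n :=
  [set x | forall t, dot (g t) x <= k%:R * h t /\
                     (t \in J -> dot (g t) x = k%:R * h t)].

Lemma dfaceS (R : realType) n (T : finType) (g : T -> 'rV[R]_n) h
    (J J' : {set T}) k x :
  J \subset J' -> dface g h J' k x -> dface g h J k x.
Proof.
move=> /subsetP sJ Jx t; have [le eq] := Jx t.
by split=> // /sJ; exact: eq.
Qed.

Lemma dfaceU1 (R : realType) n (T : finType) (g : T -> 'rV[R]_n) h
    (J : {set T}) k x t :
  dot (g t) x = k%:R * h t -> dface g h J k x -> dface g h (t |: J)%SET k x.
Proof.
move=> e Jx u; have [le eq] := Jx u.
by split=> //; rewrite !inE => /predU1P[->|/eq].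
Qed.

Lemma dface_sum (R : realType) n (T : finType) (g : T -> 'rV[R]_n) h
    (J : {set T}) (s : seq 'cV[R]_n) :
  (forall x, x \in s -> dface g h J 1 x) ->
  dface g h J (size s) (\sum_(x <- s) x).
Proof.
elim: s => [_ t|x s IHs Js t]; first by rewrite big_nil mul0r /dot mulmx0 mxE.
have [le eq] := IHs (fun y ys => Js y (mem_behead (s := x :: s) ys)) t.
have [] := Js x (mem_head _ _) t; rewrite mul1r => le1 eq1.
rewrite big_cons dotDr /= -[(size s).+1]add1n natrD mulrDl mul1r.
by split=> [|tJ]; [exact: lerD|rewrite eq // eq1].
Qed.

Lemma dface_scale (R : realType) n (T : finType) (g : T -> 'rV[R]_n) h
    (J : {set T}) (k r : nat) w :
  (0 < k)%N -> dface g h J k w -> dface g h J r ((r%:R / k%:R) *: w).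
Proof.
move=> k0 Jw t; have [le eq] := Jw t; rewrite dotZr.
have kn0 : k%:R != 0 :> R by rewrite pnatr_eq0 -lt0n.
have -> : r%:R * h t = r%:R / k%:R * (k%:R * h t).
  by rewrite mulrA divfK.
by split=> [|/eq->//]; rewrite ler_wpM2l // divr_ge0 ?ler0n.
Qed.

(** * Splitting integer vectors *)

(** Integrality of [r P] intersected with [w - (k - r) P]. The range [0 < r < k] keeps both factors
    positive, where [dface] agrees with true dilation. *)
Definition integer_split (R : realType) (n : nat) (T : finType)
    (g : T -> 'rV[R]_n) (h : T -> R) : Prop :=
  forall (k r : nat) (w : 'cV[R]_n), (0 < r < k)%N -> integer_vector w ->
  forall F, face [set y | dface g h finset.set0 r y /\
                          dface g h finset.set0 (k - r) (w - y)] F ->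
    F !=set0 -> exists x, F x /\ integer_vector x.

(** An integer vertex [y] of the set of admissible splits of [w]. The last clause says that the
    minimal faces containing [y] and [w - y] have no common nonzero direction. The hypothesis on [v]
    expresses boundedness: no nonzero recession direction exists. *)
Lemma split_vertex (R : realType) n (T : finType) (g : T -> 'rV[R]_n) h
    (J1 J0 : {set T}) (k r : nat) (w y0 : 'cV[R]_n) :
  integer_split g h -> (forall v, v != 0 -> exists t, 0 < dot (g t) v) ->
  (0 < r < k)%N -> integer_vector w ->
  dface g h J1 r y0 -> dface g h J0 (k - r) (w - y0) ->
  exists (y : 'cV[R]_n) (J1' J0' : {set T}),
    [/\ integer_vector y, J1 \subset J1' /\ J0 \subset J0',
        dface g h J1' r y, dface g h J0' (k - r) (w - y) &
        forall v, (forall t, t \in J1' :|: J0' -> dot (g t) v = 0) -> v = 0].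
Proof.
move=> gsplit bnd rk wint Jy0 Jz0.
(* One system in the variable [y]: [inl] carries the constraints on [y], [inr] those on [w - y]. *)
pose G (s : T + T) := match s with inl t => g t | inr t => - g t end.
pose H (s : T + T) := match s with
  inl t => r%:R * h t | inr t => (k - r)%:R * h t - dot (g t) w end.
have tightE y t : ((inl t \in tight G H y) = (dot (g t) y == r%:R * h t)) *
  ((inr t \in tight G H y) = (dot (g t) (w - y) == (k - r)%:R * h t)).
  rewrite !inE /G /H; split=> //.
  by rewrite dotNl dotBr; apply/eqP/eqP => e; lra.
have polyE : poly_of G H =
    [set y | dface g h finset.set0 r y /\ dface g h finset.set0 (k - r) (w - y)].
  apply/seteqP; split=> [y Qy|y [Qy Qz] [t|t]] /=.
  - split=> t; rewrite inE; split=> //; first exact: (Qy (inl t)).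
    by have := Qy (inr t); rewrite /G /H dotNl dotBr => le; lra.
  - by have [] := Qy t.
  - by have [] := Qz t; rewrite /G /H dotNl dotBr => le _; lra.
pose S0 := [set s | match s with inl t => t \in J1 | inr t => t \in J0 end]%SET.
have [||||y [Qy yint S0y ymax]] := @integer_vertex R n _ G H S0 y0.
- by rewrite polyE; exact: gsplit.
- by move=> v /bnd[t gv]; exists (inl t).
- by rewrite polyE; split; [apply: dfaceS Jy0|apply: dfaceS Jz0]; exact: finset.sub0set.
- apply/subsetP => -[t|t]; rewrite inE tightE => tJ; apply/eqP.
    by have [_ ->] := Jy0 t.
  by have [_ ->] := Jz0 t.
exists y, [set t | inl t \in tight G H y]%SET, [set t | inr t \in tight G H y]%SET.
move: Qy; rewrite polyE => -[Qy Qz]; split=> //.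
- split; apply/subsetP => t tJ; rewrite inE; apply: (subsetP S0y);
  by rewrite inE.
- by move=> t; have [le _] := Qy t; rewrite inE tightE; split=> // /eqP.
- by move=> t; have [le _] := Qz t; rewrite inE tightE; split=> // /eqP.
move=> v vJ; apply: ymax => -[t|t] ts /=.
  by apply: vJ; rewrite finset.in_setU [X in X || _]finset.in_set ts.
by rewrite dotNl vJ ?oppr0 // finset.in_setU [X in _ || X]finset.in_set ts orbT.
Qed.

Lemma integer_vectorB (R : realType) n (x y : 'cV[R]_n) :
  integer_vector x -> integer_vector y -> integer_vector (x - y).
Proof.
move=> /mxOverP xz /mxOverP yz; apply/mxOverP => i j.
by rewrite !mxE rpredB.
Qed.

(** Induction on [k]: a split with [r = 1] peels off one integer point and leaves an integer vector
    in the [(k - 1)]-fold dilate of the same face. *)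
Lemma integer_decomposition (R : realType) n (T : finType) (g : T -> 'rV[R]_n) h
    (J : {set T}) (k : nat) (w : 'cV[R]_n) :
  integer_split g h -> (forall v, v != 0 -> exists t, 0 < dot (g t) v) ->
  (0 < k)%N -> integer_vector w -> dface g h J k w ->
  exists s : seq 'cV[R]_n,
    [/\ size s = k, forall x, x \in s -> dface g h J 1 x /\ integer_vector x
      & \sum_(x <- s) x = w].
Proof.
move=> gsplit bnd; case: k => // k _; elim: k w => [|k IHk] w wint Jw.
  exists [:: w]; split=> //; last by rewrite big_seq1.
  by move=> x; rewrite inE => /eqP->.
(* The proportional split of [w] shows that the set of splits is nonempty and respects [J] on both
   sides. *)
pose y0 := (1%:R / k.+2%:R) *: w.
have [||y [J1 [J0 [yint [sJ1 sJ0] Jy Jz _]]]] :=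
    @split_vertex R n T g h J J k.+2 1 w y0 gsplit bnd isT wint.
- exact: dface_scale.
- rewrite (_ : w - y0 = (k.+1%:R / k.+2%:R) *: w); first exact: dface_scale.
  rewrite /y0 -{1}[w]scale1r -scalerBl; congr (_ *: _).
  have k2 : k.+2%:R != 0 :> R by rewrite pnatr_eq0.
  by apply: (mulIf k2); rewrite mulrBl !divfK // mul1r -natrB // subSS subn0.
have [|s [sk sJ sw]] := IHk (w - y) _ (dfaceS sJ0 Jz); first exact: integer_vectorB.
exists (y :: s); split=> [|x|]; first by rewrite /= sk.
- by rewrite inE => /predU1P[->|/sJ//]; split=> //; apply: dfaceS Jy.
- by rewrite big_cons sw addrC subrK.
Qed.

(** * Affine independence of two joined families *)

Lemma dot_affine_sum (R : realType) n (c : 'rV[R]_n) (e : R) t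
    (x : 'I_t -> 'cV[R]_n) (a : 'I_t -> R) :
  (forall i, dot c (x i) = e) -> dot c (\sum_i a i *: x i) = (\sum_i a i) * e.
Proof.
move=> xe; rewrite dot_sumr mulr_suml; apply: eq_bigr => i _.
by rewrite dotZr xe.
Qed.

Definition join (A : Type) (p q : nat) (f : 'I_p -> A) (f' : 'I_q -> A)
    (i : 'I_(p + q)) : A :=
  match split i with inl j => f j | inr j => f' j end.

Lemma join_lshift A p q (f : 'I_p -> A) (f' : 'I_q -> A) j :
  join f f' (lshift q j) = f j.
Proof. by rewrite /join (unsplitK (inl j)). Qed.

Lemma join_rshift A p q (f : 'I_p -> A) (f' : 'I_q -> A) j :
  join f f' (rshift p j) = f' j.
Proof. by rewrite /join (unsplitK (inr j)). Qed.

Definition join_shift := (join_lshift, join_rshift).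

(** Applying [c] to a vanishing combination with total weight 0 forces each family to have weight 0,
    as [e1 != e0]. The partial sum over [x] is then a direction of both faces, hence 0, and each
    family can be treated alone. *)
Lemma affinely_independent_join (R : realType) n (T : finType)
    (g : T -> 'rV[R]_n) h (J1 J0 : {set T}) p q
    (x : 'I_p -> 'cV[R]_n) (z : 'I_q -> 'cV[R]_n) (c : 'rV[R]_n) (e1 e0 : R) :
  affinely_independent x -> affinely_independent z ->
  (forall i, dface g h J1 1 (x i)) -> (forall i, dface g h J0 1 (z i)) ->
  (forall v, (forall t, t \in J1 :|: J0 -> dot (g t) v = 0) -> v = 0) ->
  (forall i, dot c (x i) = e1) -> (forall i, dot c (z i) = e0) -> e1 != e0 ->
  affinely_independent (join x z).
Proof.
move=> xind zind xJ zJ J0v xe ze ne a; rewrite !big_split_ord /=.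
pose a1 i := a (lshift q i); pose a0 i := a (rshift p i).
move=> sa sax'; have sax : \sum_i a1 i *: x i + \sum_i a0 i *: z i = 0.
  by rewrite -[RHS]sax'; congr (_ + _); apply: eq_bigr => j _; rewrite join_shift.
have sa1 : \sum_i a1 i = 0.
  have := congr1 (dot c) sax.
  rewrite dotDr (dot_affine_sum _ xe) (dot_affine_sum _ ze).
  rewrite /dot mulmx0 mxE (_ : \sum_i a0 i = - \sum_i a1 i); last first.
    by apply/eqP; rewrite -addr_eq0 addrC sa.
  rewrite mulNr -mulrBr => /eqP; rewrite mulf_eq0 subr_eq0 (negPf ne) orbF.
  by move/eqP.
have sa0 : \sum_i a0 i = 0 by move: sa; rewrite sa1 add0r.
have v0 : \sum_i a1 i *: x i = 0.
  apply: J0v => t; rewrite finset.in_setU => /orP[tJ|tJ].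
    rewrite (dot_affine_sum (e := 1%:R * h t)) ?sa1 ?mul0r // => i.
    by have [_ ->] := xJ i t.
  rewrite (_ : \sum_i _ = - \sum_i a0 i *: z i); last first.
    by apply/eqP; rewrite -addr_eq0 sax.
  rewrite dotNr (dot_affine_sum (e := 1%:R * h t)) ?sa0 ?mul0r ?oppr0 // => i.
  by have [_ ->] := zJ i t.
have v0' : \sum_i a0 i *: z i = 0 by move: sax; rewrite v0 add0r.
move=> i; rewrite -[i]splitK; case: (split i) => j /=.
  exact: xind sa1 v0 j.
exact: zind sa0 v0' j.
Qed.

(** * Induction on the free coordinates inside a unit box *)

(** The box inequalities are named by indices [lo i] and [hi i], so that fixing coordinate [i]
    amounts to adding one of them to [J]. *)
Definition in_unit_box (R : realType) (n : nat) (T : finType)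
    (g : T -> 'rV[R]_n) (h : T -> R) (l : 'I_n -> int) (lo hi : 'I_n -> T) :=
  forall i, [/\ g (lo i) = - delta_mx 0 i, h (lo i) = - (l i)%:~R,
                g (hi i) = delta_mx 0 i & h (hi i) = (l i + 1)%:~R].

Lemma unit_box_bounded (R : realType) n (T : finType) (g : T -> 'rV[R]_n) h
    l lo hi (v : 'cV[R]_n) :
  in_unit_box g h l lo hi -> v != 0 -> exists t, 0 < dot (g t) v.
Proof.
move=> gbox v0; have [i vi] : exists i, v i 0 != 0.
  apply: contrapT => /forallNP vz; case/eqP: v0; apply/matrixP => i j.
  by rewrite ord1 mxE; apply/eqP/negP => /negP; exact: vz.
have [glo _ ghi _] := gbox i; have [vpos|vneg] := ltP 0 (v i 0).
  by exists (hi i); rewrite ghi dot_delta.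
by exists (lo i); rewrite glo dotNl dot_delta oppr_gt0 lt_neqAle vi.
Qed.

(** Stated for every face [J] because the induction passes to smaller faces, each fixing at least
    one more coordinate. *)
Lemma icp_dface (R : realType) n (T : finType) (g : T -> 'rV[R]_n) h l lo hi :
  in_unit_box g h l lo hi -> integer_split g h ->
  forall (J : {set T}) (k : nat) (w : 'cV[R]_n),
  (0 < k)%N -> integer_vector w -> dface g h J k w ->
  exists (t : nat) (x : 'I_t -> 'cV[R]_n) (m : 'I_t -> nat),
    [/\ affinely_independent x,
        forall i, dface g h J 1 (x i) /\ integer_vector (x i),
        (\sum_i m i = k)%N & w = \sum_i (m i)%:R *: x i].
Proof.
move=> gbox gsplit J; have bnd v := unit_box_bounded (v := v) gbox.
pose free (J : {set T}) := [set i | (lo i \notin J) && (hi i \notin J)]%SET.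
have [N] := ubnP #|free J|; elim: N J => // N IHN J leN k w k0 wint Jw.
(* With no free coordinate, [J] prescribes an integer value for each coordinate, so [w / k] is an
   integer point, taken [k] times. *)
case: (set_0Vmem (free J)) => [fixed|[i ifree]].
  pose p := (1%:R / k%:R) *: w.
  have Jp : dface g h J 1 p by exact: dface_scale.
  have kn0 : k%:R != 0 :> R by rewrite pnatr_eq0 -lt0n.
  exists 1%N, (fun=> p), (fun=> k); split.
  - by move=> a; rewrite big_ord1 => a0 _ i; rewrite ord1.
  - move=> _; split=> //; apply/mxOverP => i j; rewrite ord1.
    have [glo hlo ghi hhi] := gbox i.
    have := finset.in_set0 i; rewrite -fixed finset.in_set => /negbT.
    rewrite negb_and !negbK => /orP[loJ|hiJ].
      have [_ /(_ loJ)] := Jp (lo i).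
      rewrite glo hlo dotNl dot_delta mul1r => /oppr_inj ->; exact: intr_int.
    have [_ /(_ hiJ)] := Jp (hi i).
    by rewrite ghi hhi dot_delta mul1r => ->; exact: intr_int.
  - by rewrite big_ord1.
  - by rewrite big_ord1 scalerA mulrC divfK // scale1r.
have [glo hlo ghi hhi] := gbox i.
have step t : t \in [set lo i; hi i]%SET -> (#|free (t |: J)%SET| < N)%N.
  move=> ti; rewrite -ltnS; apply: leq_trans leN; rewrite ltnS.
  apply: proper_card; apply/properP; split.
    apply/subsetP => j; rewrite !inE !negb_or.
    by case/andP => /andP[_ ->] /andP[_ ->].
  exists i => //; rewrite !inE !negb_or.
  by case/set2P: ti => ->; rewrite eqxx ?andbF.
have [s [sk sJ sw]] := integer_decomposition gsplit bnd k0 wint Jw.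
pose up (x : 'cV[R]_n) := x i 0 == (l i + 1)%:~R.
pose s1 := filter up s; pose s0 := filter (predC up) s.
have s1J : dface g h (hi i |: J)%SET (size s1) (\sum_(x <- s1) x).
  apply: dface_sum => x; rewrite mem_filter => /andP[/eqP xi /sJ[Jx _]].
  by apply: dfaceU1 => //; rewrite ghi hhi dot_delta mul1r.
have s0J : dface g h (lo i |: J)%SET (size s0) (\sum_(x <- s0) x).
  apply: dface_sum => x; rewrite mem_filter => /andP[/= xi /sJ[Jx xint]].
  apply: dfaceU1 => //; rewrite glo hlo dotNl dot_delta mul1r.
  have [lelo _] := Jx (lo i); have [lehi _] := Jx (hi i).
  move: xi lelo lehi; rewrite glo hlo ghi hhi dotNl !dot_delta !mul1r lerN2 /up.
  (* An integer in the interval from [l i] to [l i + 1] other than the upper end is [l i]. *)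
  have /intrP[z ->] := mxOverP xint i 0; rewrite eqr_int !ler_int => ne le1 le2.
  by congr (- _%:~R); lia.
have sumw : \sum_(x <- s1) x + \sum_(x <- s0) x = w.
  by rewrite /s1 /s0 !big_filter -[RHS]sw [RHS](bigID up).
have sizek : (size s1 + size s0)%N = k.
  by rewrite /s1 /s0 !size_filter count_predC.
have weaken t (J' : {set T}) : J \subset J' -> forall x : 'I_t -> 'cV[R]_n,
    (forall i, dface g h J' 1 (x i) /\ integer_vector (x i)) ->
    forall i, dface g h J 1 (x i) /\ integer_vector (x i).
  by move=> sJ' x xJ j; have [xJ' ?] := xJ j; split=> //; exact: dfaceS xJ'.
(* If one group is empty, all summands agree in coordinate [i], and [w] itself lies in the dilate of
   a smaller face. *)
case: (posnP (size s1)) => [/size0nil s1nil|s1pos].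
  have w0 : dface g h (lo i |: J)%SET k w.
    by rewrite -sizek -sumw s1nil big_nil add0r.
  have [|t [x [m [xind xJ sm xw]]]] := IHN _ (step (lo i) _) k w k0 wint w0.
    by rewrite set21.
  by exists t, x, m; split=> //; apply: weaken xJ; exact: finset.subsetUr.
case: (posnP (size s0)) => [/size0nil s0nil|s0pos].
  have w1 : dface g h (hi i |: J)%SET k w.
    by rewrite -sizek -sumw s0nil big_nil addr0 addn0.
  have [|t [x [m [xind xJ sm xw]]]] := IHN _ (step (hi i) _) k w k0 wint w1.
    by rewrite set22.
  by exists t, x, m; split=> //; apply: weaken xJ; exact: finset.subsetUr.
(* Both groups are nonempty: the sum over [s1] is only the starting point, to be replaced by a
   vertex [y] of the set of splits. *)
have rk : (0 < size s1 < k)%N by lia.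
have ks0 : (k - size s1 = size s0)%N by lia.
have [|y [J1 [J0 [yint [sJ1 sJ0] Jy Jz J10]]]] :=
    @split_vertex R n T g h _ (lo i |: J)%SET k _ w _ gsplit bnd rk wint s1J _.
  by rewrite ks0 -sumw [X in X - _]addrC addrK.
rewrite ks0 in Jz.
have shrink (J' : {set T}) t : t \in [set lo i; hi i]%SET ->
    (t |: J)%SET \subset J' -> (#|free J'| < N)%N.
  move=> ti tJ'; apply: leq_ltn_trans (step t ti); apply: subset_leq_card.
  apply/subsetP => j; rewrite /free finset.in_set finset.in_set.
  by move=> /andP[loJ hiJ]; apply/andP; split;
    [apply: contra loJ|apply: contra hiJ]; exact: subsetP.
have [|p [x [m [xind xJ sm xw]]]] := IHN J1 (shrink _ _ _ sJ1) _ y s1pos yint Jy.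
  by rewrite set22.
have [||q [z [m' [zind zJ sm' zw]]]] :=
    IHN J0 (shrink _ _ _ sJ0) _ (w - y) s0pos _ Jz.
- by rewrite set21.
- exact: integer_vectorB.
exists (p + q)%N, (join x z), (join m m'); split.
(* Coordinate [i] separates the two families, with values [l i + 1] and [l i]. *)
- apply: (affinely_independent_join (g := g) (h := h) (J1 := J1) (J0 := J0)
    (c := delta_mx 0 i) (e1 := (l i + 1)%:~R) (e0 := (l i)%:~R)) => //.
  + by move=> j; have [] := xJ j.
  + by move=> j; have [] := zJ j.
  + move=> j; have [/(_ (hi i))[_] + _] := xJ j; rewrite ghi hhi mul1r; apply.
    by rewrite (subsetP sJ1) // finset.setU11.
  + move=> j; have [/(_ (lo i))[_] + _] := zJ j; rewrite glo hlo mul1r dotNl.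
    by move=> e; apply: oppr_inj; apply: e; rewrite (subsetP sJ0) // finset.setU11.
  + by rewrite eqr_int; lia.
- have sJ1' := subset_trans (finset.subsetUr _ _) sJ1.
  have sJ0' := subset_trans (finset.subsetUr _ _) sJ0.
  move=> j; rewrite /join; case: (split j) => j'.
    exact: weaken sJ1' _ xJ j'.
  exact: weaken sJ0' _ zJ j'.
- rewrite big_split_ord /= -sizek -sm -sm'.
  by congr (_ + _)%N; apply: eq_bigr => j _; rewrite join_shift.
- rewrite big_split_ord /= -[LHS](subrK y) addrC zw {1}xw.
  by congr (_ + _); apply: eq_bigr => j _; rewrite !join_shift.
Qed.

(** * From box-integrality to integral splits *)

Definition box_lhs (R : realType) (m n : nat) (A : 'M[R]_(m, n))
    (t : 'I_m + ('I_n + 'I_n)) : 'rV[R]_n :=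
  match t with
  | inl i => row i A
  | inr (inl j) => - delta_mx 0 j
  | inr (inr j) => delta_mx 0 j
  end.

Definition box_rhs (R : realType) (m n : nat) (b : 'cV[R]_m) (l : 'I_n -> int)
    (t : 'I_m + ('I_n + 'I_n)) : R :=
  match t with
  | inl i => b i 0
  | inr (inl j) => - (l j)%:~R
  | inr (inr j) => (l j + 1)%:~R
  end.

Lemma dface_boxP (R : realType) m n (A : 'M[R]_(m, n)) b l k (x : 'cV[R]_n) :
  dface (box_lhs A) (box_rhs b l) finset.set0 k x <->
  (forall i, (A *m x) i 0 <= k%:R * b i 0) /\
  (forall j, k%:R * (l j)%:~R <= x j 0 <= k%:R * (l j + 1)%:~R).
Proof.
have rowE i : dot (row i A) x = (A *m x) i 0 by rewrite /dot -row_mul mxE.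
split=> [Px|[Ax Bx] t].
  split=> [i|j]; first by have [] := Px (inl i); rewrite /= rowE.
  have [+ _] := Px (inr (inl j)); have [+ _] := Px (inr (inr j)).
  by rewrite /= dotNl !dot_delta mulrN lerN2 => -> ->.
split=> [|]; last by rewrite inE.
case: t => [i|[j|j]] /=; first by rewrite rowE.
  by rewrite dotNl dot_delta mulrN lerN2; case/andP: (Bx j).
by rewrite dot_delta; case/andP: (Bx j).
Qed.

Lemma dilate_halfspaces (R : realType) m n (A : 'M[R]_(m, n)) b k
    (x : 'cV[R]_n) :
  (0 < k)%N ->
  dilate k%:R (halfspaces A b) x <-> forall i, (A *m x) i 0 <= k%:R * b i 0.
Proof.
move=> k0; have kp : 0 < k%:R :> R by rewrite ltr0n.
split=> [[y Py <-] i|Px].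
  by rewrite -scalemxAr mxE ler_pM2l.
exists (k%:R^-1 *: x); last by rewrite scalerA divff ?scale1r // lt0r_neq0.
by move=> i; rewrite -scalemxAr mxE ler_pdivrMl.
Qed.

Lemma sub_dilateP (R : realType) n (w : 'cV[R]_n) (a : R) P x :
  sub_dilate w a P x <-> dilate a P (w - x).
Proof.
split=> -[y Py e]; exists y => //; first by rewrite -e opprB addrC subrK.
by rewrite e opprB addrC subrK.
Qed.

(** Since [w] is an integer vector, the unit-box constraints on both parts of a split combine into
    one box for [y] with integer bounds, to which box-integrality applies. *)
Lemma box_integer_split (R : realType) m n (A : 'M[R]_(m, n)) (b : 'cV[R]_m)
    (l : 'I_n -> int) :
  (forall (k r : nat) (w : 'cV[R]_n), (r <= k)%N -> integer_vector w ->
     box_integer (dilate r%:R (halfspaces A b) `&`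
                  sub_dilate w (k - r)%N%:R (halfspaces A b))) ->
  integer_split (box_lhs A) (box_rhs b l).
Proof.
move=> PA k r w /andP[r0 rk] wint F faceF [y0 Fy0].
have [W wW] : exists W : 'I_n -> int, forall j, w j 0 = (W j)%:~R.
  exists (fun j => Num.floor (w j 0)) => j.
  by rewrite floorK //; exact: (mxOverP wint).
have k'0 : (0 < k - r)%N by rewrite subn_gt0.
set k' := (k - r)%N in k'0 faceF *.
(* The first bound in each of [lo] and [hi] comes from [y], the second from [w - y]. *)
pose lo j : int := Num.max (r%:Z * l j) (W j - k'%:Z * (l j + 1)).
pose hi j : int := Num.min (r%:Z * (l j + 1)) (W j - k'%:Z * l j).
pose c : 'cV[\bar int]_n := \col_j (lo j)%:E.
pose d : 'cV[\bar int]_n := \col_j (hi j)%:E.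
have boxE (y : 'cV[R]_n) : box c d y <->
    forall j, (lo j)%:~R <= y j 0 <= (hi j)%:~R.
  by split=> By j; have := By j; rewrite !mxE /= !lee_fin.
have loE (a : R) j : ((lo j)%:~R <= a) =
    (r%:R * (l j)%:~R <= a) && ((W j)%:~R - k'%:R * (l j + 1)%:~R <= a).
  rewrite (_ : (lo j)%:~R = Num.max (r%:R * (l j)%:~R)
      ((W j)%:~R - k'%:R * (l j + 1)%:~R)) ?ge_max //.
  by rewrite !pmulrn -!intrM -intrB maxEle ler_int /lo maxEle; case: ifP.
have hiE (a : R) j : (a <= (hi j)%:~R) =
    (a <= r%:R * (l j + 1)%:~R) && (a <= (W j)%:~R - k'%:R * (l j)%:~R).
  rewrite (_ : (hi j)%:~R = Num.min (r%:R * (l j + 1)%:~R)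
      ((W j)%:~R - k'%:R * (l j)%:~R)) ?le_min //.
  by rewrite !pmulrn -!intrM -intrB minEle ler_int /hi minEle; case: ifP.
have setE : [set y | dface (box_lhs A) (box_rhs b l) finset.set0 r y /\
                dface (box_lhs A) (box_rhs b l) finset.set0 k' (w - y)] =
    dilate r%:R (halfspaces A b) `&` sub_dilate w k'%:R (halfspaces A b)
    `&` box c d.
  apply/seteqP; split=> y /=.
    move=> [/dface_boxP[Ay By] /dface_boxP[Az Bz]]; split; first split.
    - exact/dilate_halfspaces.
    - exact/sub_dilateP/dilate_halfspaces.
    - apply/boxE => j; rewrite loE hiE; have := By j; have := Bz j.
      by rewrite !mxE wW; lra.
  move=> [[/dilate_halfspaces-/(_ r0) Ay]].
  move=> /sub_dilateP/dilate_halfspaces-/(_ k'0) Az /boxE By.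
  split; apply/dface_boxP; split=> // j; have := By j; rewrite loE hiE.
    by lra.
  by rewrite !mxE wW; lra.
(* The bounds are ordered because the point [y0] of [F] lies in the box. *)
have cd j : (c j 0%R <= d j 0%R)%E.
  rewrite !mxE lee_fin -(ler_int R).
  have : F `<=` box c d.
    by case: faceF => cF [dF [_ ->]] y [+ _]; rewrite setE => -[].
  by move=> /(_ _ Fy0)/boxE/(_ j)/andP[]; exact: le_trans.
move: faceF; rewrite setE => faceF.
have [_ /(_ c d cd)[_ intF]] := PA k r w (ltnW rk) wint.
by apply: intF faceF _; exists y0.
Qed.

(** * The Integer Carathéodory Property *)

Theorem theorem1 (R : realType) (n : nat) (P : set 'cV[R]_n) :
  calP P -> ICP P.
Proof.
move=> [[m [A' [b' ->]]]]; set A := map_mx _ A'; set b := map_mx _ b' => PA.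
move=> k w k0 wint /(dilate_halfspaces _ _ _ k0) Aw.
(* This choice puts [w / k] into the unit box at [l]. *)
pose l j := Num.floor (w j 0 / k%:R).
pose lo (j : 'I_n) : 'I_m + ('I_n + 'I_n) := inr (inl j).
pose hi (j : 'I_n) : 'I_m + ('I_n + 'I_n) := inr (inr j).
have kp : 0 < k%:R :> R by rewrite ltr0n.
have kw : dface (box_lhs A) (box_rhs b l) finset.set0 k w.
  apply/dface_boxP; split=> // j.
  rewrite mulrC -ler_pdivlMr // floor_le mulrC -ler_pdivrMr //.
  exact/ltW/floorD1_gt.
have gbox : in_unit_box (box_lhs A) (box_rhs b l) l lo hi by [].
have [t [x [mu [xind xP smu wx]]]] :=
  icp_dface gbox (box_integer_split PA) k0 wint kw.
exists t, x, mu; split=> // i; have [/dface_boxP[xA _] xint] := xP i.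
by split=> // j; have := xA j; rewrite mul1r.
Qed.
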